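(* Let $\mathcal{E}\stackrel{i}{\hookrightarrow}\mathcal{C}\stackrel{i}{\hookleftarrow}\mathcal{M}$ be a bilinear factorization system on a small category $\mathcal{C}$. Then there is a canonically associated orthogonal factorization system $\overline{\mathcal{E}}\hookrightarrow\mathcal{C}\hookleftarrow\overline{\mathcal{M}}$ (the one described in the context) such that the functors $i:\mathcal{E}\to\mathcal{C}$ and $i:\mathcal{M}\to\mathcal{C}$ factorize through $\overline{\mathcal{E}}$ and $\overline{\mathcal{M}}$, respectively.
   Context: Composites are written $gf$ for ''first $f$, then $g$''. **Bilinear factorization systems.** A subcategory $\mathcal{E}\hookrightarrow\mathcal{C}$ here means a category $\mathcal{E}$ with an identity-on-objects functor $i:\mathcal{E}\to\mathcal{C}$ which is injective on morphisms. A bilinear factorization system on a small category $\mathcal{C}$ consists of subcategories $i:\mathcal{E}\hookrightarrow\mathcal{C}$ and $i:\mathcal{M}\hookrightarrow\mathcal{C}$, both containing all identity morphisms, together with an assignment to every morphism $g:a\to b$ in $\mathcal{C}$ of an object $F(g)$, a morphism $\epsilon(g):a\to F(g)$ in $\mathcal{E}$ and a morphism $\mu(g):F(g)\to b$ in $\mathcal{M}$, such that $g=i\mu(g)\,i\epsilon(g)$ for every $g$, and for all $e:a\to b$ in $\mathcal{E}$, $g:b\to c$ in $\mathcal{C}$, $m:c\to d$ in $\mathcal{M}$: $$\epsilon(i(m)g)=\epsilon(g),\quad \epsilon(g\,i(e))=\epsilon(g)e,\quad \mu(i(m)g)=m\mu(g),\quad \mu(g\,i(e))=\mu(g)$$ (including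 equality of the objects $F(i(m)g)=F(g)=F(g\,i(e))$). **Orthogonal factorization systems.** An orthogonal factorization system on $\mathcal{C}$ is given by subcategories $\overline{\mathcal{E}}\hookrightarrow\mathcal{C}\hookleftarrow\overline{\mathcal{M}}$, both containing all isomorphisms of $\mathcal{C}$, such that any morphism $f$ of $\mathcal{C}$ admits a (not necessarily unique) decomposition $f=me$ with $e$ in $\overline{\mathcal{E}}$ and $m$ in $\overline{\mathcal{M}}$, and such that for all $e:x\to a$ in $\overline{\mathcal{E}}$, $m:y\to b$ in $\overline{\mathcal{M}}$ and all morphisms $u:x\to y$, $v:a\to b$ in $\mathcal{C}$ with $mu=ve$ there is a unique morphism $t:a\to y$ in $\mathcal{C}$ with $te=u$ and $mt=v$. **The canonical association.** Let $\mathcal{C}^2$ be the arrow category of $\mathcal{C}$ (objects: morphisms of $\mathcal{C}$; morphisms from $f:a\to x$ to $g:b\to y$: pairs $(u:a\to b,v:x\to y)$ with $gu=vf$). A bilinear factorization system determines a functor $F:\mathcal{C}^2\to\mathcal{C}$ (a strictly associative pseudoalgebra structure for the 2-monad $(-)^2$ on $\mathsf{Cat}$) with object map $f\mapsto F(f)$ and with $$F(u,v)=i\mu\big(i\epsilon(g)\,i\mu(u)\big)\;i\epsilon\big(i\epsilon(v)\,i\mu(f)\big):F(f)\to F(vf)=F(gu)\to F(g)$$ for $(u,v):f\to g$ in $\mathcal{C}^2$. To such a pseudoalgebra is associated the pair of subcategories consisting of all objects and the following morphisms: a morphism $f:a\to x$ of $\mathcal{C}$ belongs to $\overline{\mathcal{E}}$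 iff $F(f,1_x):F(f)\to F(1_x)$ is an isomorphism (where $(f,1_x):f\to 1_x$ in $\mathcal{C}^2$), and belongs to $\overline{\mathcal{M}}$ iff $F(1_a,f):F(1_a)\to F(f)$ is an isomorphism (where $(1_a,f):1_a\to f$ in $\mathcal{C}^2$). *)

(* Defs.v *)
From Stdlib Require Import ProofIrrelevance Setoid.
Import EqNotations.

Set Implicit Arguments.
Unset Strict Implicit.

(* A category with set of objects [O].  The set of objects is a parameter, so
   that "identity on objects" can be said by sharing it. *)
Record category (O : Type) : Type := Category {
  hom :> O -> O -> Type;
  idm : forall a, hom a a;
  comp : forall a b c, hom b c -> hom a b -> hom a c;
  comp_assoc : forall a b c d (h : hom c d) (g : hom b c) (f : hom a b),
    comp h (comp g f) = comp (comp h g) f;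
  comp_idl : forall a b (f : hom a b), comp (idm b) f = f;
  comp_idr : forall a b (f : hom a b), comp f (idm a) = f
}.

Arguments idm {O C} a : rename.
Arguments comp {O C a b c} _ _ : rename.

Declare Scope cat_scope.
Delimit Scope cat_scope with cat.
Open Scope cat_scope.

(* [g ∘ f] is "first f, then g". *)
Notation "g ∘ f" := (comp g f) (at level 40, left associativity) : cat_scope.

Definition is_iso {O} {C : category O} {a b : O} (f : C a b) : Prop :=
  exists g : C b a, g ∘ f = idm a /\ f ∘ g = idm b.

Record functor {O P} (C : category O) (D : category P) : Type := Functor {
  fobj :> O -> P;
  fmap : forall a b, C a b -> D (fobj a) (fobj b);
  fmap_id : forall a, fmap (idm a) = idm (fobj a);
  fmap_comp : forall a b c (g : C b c) (f : C a b),
    fmap (g ∘ f) = fmap g ∘ fmap f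
}.

Arguments fmap {O P C D} _ {a b} _.

Record ioo_functor {O} (D C : category O) : Type := IooFunctor {
  imap :> forall a b, D a b -> C a b;
  imap_id : forall a, imap (idm a) = idm a;
  imap_comp : forall a b c (g : D b c) (f : D a b),
    imap (g ∘ f) = imap g ∘ imap f
}.

Arguments imap {O D C} _ {a b} _.

(* Being the identity on objects, [incl] reaches every identity morphism of [C]
   and is injective on morphisms as soon as it is so on every hom-set. *)
Record subcategory {O} (C : category O) : Type := Subcategory {
  subcat :> category O;
  incl : ioo_functor subcat C;
  incl_inj : forall a b (f g : subcat a b),
    imap incl f = imap incl g -> f = g
}.

Notation ι := (imap (incl _)).

Definition in_sub {O} {C : category O} (D : subcategory C) {a b : O}
    (f : C a b) : Prop :=
  exists f' : D a b, ι f' = f.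

(* A functor commuting with two identity-on-objects inclusions is itself the
   identity on objects. *)
Definition factors_through {O} {C : category O} (D D' : subcategory C) : Prop :=
  exists J : ioo_functor D D', forall a b (f : D a b), ι (imap J f) = ι f.

(* The equations between the values of [eps] (resp. [mu]) relate hom-sets that
   agree only through [mid_ml] or [mid_er], hence the transports. *)
Record bilinear_fs {O} {C : category O} (E M : subcategory C) : Type :=
  BilinearFS {
  mid : forall a b, C a b -> O;
  eps : forall a b (g : C a b), E a (mid g);
  mu : forall a b (g : C a b), M (mid g) b;
  mu_eps : forall a b (g : C a b), g = ι (mu g) ∘ ι (eps g);
  mid_ml : forall b c d (m : M c d) (g : C b c), mid (ι m ∘ g) = mid g;
  mid_er : forall a b c (g : C b c) (e : E a b), mid (g ∘ ι e) = mid g;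
  eps_ml : forall b c d (m : M c d) (g : C b c),
    rew [fun x => E b x] mid_ml m g in eps (ι m ∘ g) = eps g;
  eps_er : forall a b c (g : C b c) (e : E a b),
    rew [fun x => E a x] mid_er g e in eps (g ∘ ι e) = eps g ∘ e;
  mu_ml : forall b c d (m : M c d) (g : C b c),
    rew [fun x => M x d] mid_ml m g in mu (ι m ∘ g) = m ∘ mu g;
  mu_er : forall a b c (g : C b c) (e : E a b),
    rew [fun x => M x c] mid_er g e in mu (g ∘ ι e) = mu g
}.

Arguments mid {O C E M} _ {a b} g.
Arguments eps {O C E M} _ {a b} g.
Arguments mu {O C E M} _ {a b} g.

Record orthogonal_fs {O} {C : category O} (E M : subcategory C) : Prop :=
  OrthogonalFS {
  iso_left : forall a b (f : C a b), is_iso f -> in_sub E f;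
  iso_right : forall a b (f : C a b), is_iso f -> in_sub M f;
  decomposition : forall a b (f : C a b),
    exists (x : O) (e : E a x) (m : M x b), f = ι m ∘ ι e;
  orthogonality : forall x a y b (e : E x a) (m : M y b)
      (u : C x y) (v : C a b),
    ι m ∘ u = v ∘ ι e ->
    exists! t : C a y, t ∘ ι e = u /\ ι m ∘ t = v
}.

Section ArrowCategory.
Context {O : Type} (C : category O).

Record arrow : Type := Arrow { src : O; tgt : O; arr : C src tgt }.

Record square (f g : arrow) : Type := Square {
  top : C (src f) (src g);
  bot : C (tgt f) (tgt g);
  square_comm : arr g ∘ top = bot ∘ arr f
}.

Lemma square_eq (f g : arrow) (s t : square f g) :
  top s = top t -> bot s = bot t -> s = t.
Proof.
destruct s as [u v p], t as [u' v' q]; simpl; intros -> ->.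
now rewrite (proof_irrelevance _ p q).
Qed.

Lemma square_id_comm (f : arrow) : arr f ∘ idm (src f) = idm (tgt f) ∘ arr f.
Proof. now rewrite comp_idl, comp_idr. Qed.

Definition square_id (f : arrow) : square f f := Square (square_id_comm f).

Lemma square_comp_comm (f g h : arrow) (t : square g h) (s : square f g) :
  arr h ∘ (top t ∘ top s) = (bot t ∘ bot s) ∘ arr f.
Proof.
now rewrite comp_assoc, square_comm, <- comp_assoc, square_comm, comp_assoc.
Qed.

Definition square_comp (f g h : arrow) (t : square g h) (s : square f g) :
  square f h := Square (square_comp_comm t s).

Lemma square_assoc (f g h k : arrow)
    (u : square h k) (t : square g h) (s : square f g) :
  square_comp u (square_comp t s) = square_comp (square_comp u t) s.
Proof. apply square_eq; simpl; apply comp_assoc. Qed.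

Lemma square_idl (f g : arrow) (s : square f g) :
  square_comp (square_id g) s = s.
Proof. apply square_eq; simpl; apply comp_idl. Qed.

Lemma square_idr (f g : arrow) (s : square f g) :
  square_comp s (square_id f) = s.
Proof. apply square_eq; simpl; apply comp_idr. Qed.

Definition arrow_cat : category arrow :=
  Category square_assoc square_idl square_idr.

End ArrowCategory.

Section AssociatedClasses.
Context {O : Type} {C : category O} (F : functor (arrow_cat C) C).

(* (f, 1_x) : f -> 1_x and (1_a, f) : 1_a -> f in the arrow category. *)
Definition to_id {a x} (f : C a x) :
    arrow_cat C (Arrow f) (Arrow (idm x)) :=
  @Square O C (Arrow f) (Arrow (idm x)) f (idm x) eq_refl.

Definition from_id {a x} (f : C a x) :
    arrow_cat C (Arrow (idm a)) (Arrow f) :=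
  @Square O C (Arrow (idm a)) (Arrow f) (idm a) f eq_refl.

Definition left_class {a x} (f : C a x) : Prop := is_iso (fmap F (to_id f)).

Definition right_class {a x} (f : C a x) : Prop := is_iso (fmap F (from_id f)).

End AssociatedClasses.

(* The identity morphism, between objects that are equal but not necessarily
   convertible. *)
Definition eq_hom {O} {C : category O} {x y : O} (p : x = y) : C x y :=
  rew [fun z => C x z] p in idm x.

Section BilinearFunctor.
Context {O : Type} {C : category O} {E M : subcategory C}.
Variable B : bilinear_fs E M.

Local Notation F := (mid B).
Local Notation ε := (eps B).
Local Notation μ := (mu B).

Lemma mid_bot {a x y} (f : C a x) (v : C x y) :
  F (v ∘ f) = F (ι (ε v) ∘ ι (μ f)).
Proof.
rewrite (mu_eps B v) at 1; rewrite (mu_eps B f) at 1.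
rewrite <- (comp_assoc (ι (μ v))), (mid_ml B), comp_assoc.
now rewrite (mid_er B).
Qed.

Lemma mid_square (f g : arrow C) (s : square f g) :
  F (ι (ε (bot s)) ∘ ι (μ (arr f))) = F (ι (ε (arr g)) ∘ ι (μ (top s))).
Proof. now rewrite <- mid_bot, <- mid_bot, square_comm. Qed.

(* The intermediate objects F(i ε(v) i μ(f)) and F(i ε(g) i μ(u)) are both equal
   to F(vf) = F(gu), hence the identity morphism between them. *)
Definition bfs_fmap (f g : arrow C) (s : square f g) : C (F (arr f)) (F (arr g)) :=
  ι (μ (ι (ε (arr g)) ∘ ι (μ (top s))))
  ∘ eq_hom (mid_square s)
  ∘ ι (ε (ι (ε (bot s)) ∘ ι (μ (arr f)))).

(* Morphisms of E and M are stable under transport, which lets the transports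
   be absorbed into [m] and [e] below. *)
Lemma in_sub_eq_hom (D : subcategory C) {x y} (p : x = y) : in_sub D (eq_hom p).
Proof. destruct p; exists (idm x); apply imap_id. Qed.

Lemma in_sub_comp (D : subcategory C) {x y z} (g : C y z) (f : C x y) :
  in_sub D g -> in_sub D f -> in_sub D (g ∘ f).
Proof. intros [g' <-] [f' <-]; exists (g' ∘ f'); apply imap_comp. Qed.

Lemma in_sub_ι (D : subcategory C) {x y} (f : D x y) : in_sub D (ι f).
Proof. now exists f. Qed.

Lemma eq_hom_refl {x} (p : x = x) : eq_hom p = idm x :> C x x.
Proof. now rewrite (proof_irrelevance _ p eq_refl). Qed.

Lemma eq_hom_trans {x y z} (q : y = z) (p : x = y) (r : x = z) :
  eq_hom q ∘ eq_hom p = eq_hom r :> C x z.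
Proof.
destruct q, p; rewrite (proof_irrelevance _ r eq_refl); apply comp_idl.
Qed.

Lemma eq_hom_cancel {x y z} (p : x = y) (f g : C y z) :
  f ∘ eq_hom p = g ∘ eq_hom p -> f = g.
Proof. destruct p; simpl; now rewrite !comp_idr. Qed.

Lemma eq_hom_swap {x y y' z b} (f : C z b)
    (p : y = z) (q : x = y) (p' : y' = z) (q' : x = y') :
  f ∘ eq_hom p ∘ eq_hom q = f ∘ eq_hom p' ∘ eq_hom q'.
Proof.
destruct q, q', p; now rewrite (proof_irrelevance _ p' eq_refl).
Qed.

Lemma eq_hom_glue {a b x1 x2 u w y y' z}
    (m1 : C x2 b) (m2 : C z b) (e1 : C a x1) (e2 : C a z)
    (p1 : y = x2) (p2 : y' = z) (p3 : y = y')
    (q1 : w = z) (q2 : x1 = w) (r : u = x2) (r' : x1 = u) :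
  m1 ∘ eq_hom p1 = m2 ∘ eq_hom p2 ∘ eq_hom p3 ->
  eq_hom q1 ∘ (eq_hom q2 ∘ e1) = e2 ->
  m1 ∘ eq_hom r ∘ (eq_hom r' ∘ e1) = m2 ∘ e2.
Proof.
destruct r', q2, q1, p1, p3, p2.
rewrite (proof_irrelevance _ r eq_refl); simpl; rewrite !comp_idl, !comp_idr.
now intros -> ->.
Qed.

Lemma ι_rew_cod (D : subcategory C) {a x y} (p : x = y) (f : D a x) :
  ι (rew [fun z => D a z] p in f) = eq_hom p ∘ ι f.
Proof. destruct p; symmetry; apply comp_idl. Qed.

Lemma ι_rew_dom (D : subcategory C) {b x y} (p : x = y) (f : D x b) :
  ι f = ι (rew [fun z => D z b] p in f) ∘ eq_hom p.
Proof. destruct p; symmetry; apply comp_idr. Qed.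

Lemma eps_cong {a b} (g g' : C a b) (p : F g = F g') :
  g = g' -> ι (ε g') = eq_hom p ∘ ι (ε g).
Proof. intros q; destruct q; now rewrite eq_hom_refl, comp_idl. Qed.

Lemma mu_cong {a b} (g g' : C a b) (p : F g = F g') :
  g = g' -> ι (μ g) = ι (μ g') ∘ eq_hom p.
Proof. intros q; destruct q; now rewrite eq_hom_refl, comp_idr. Qed.

Lemma mid_M {b c d} (m : C c d) (g : C b c) : in_sub M m -> F (m ∘ g) = F g.
Proof. intros [n <-]; apply mid_ml. Qed.

Lemma mid_E {a b c} (g : C b c) (e : C a b) : in_sub E e -> F (g ∘ e) = F g.
Proof. intros [n <-]; apply mid_er. Qed.

Lemma eps_M {b c d} (m : C c d) (g : C b c) (p : F (m ∘ g) = F g) :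
  in_sub M m -> eq_hom p ∘ ι (ε (m ∘ g)) = ι (ε g).
Proof.
intros [n q]; destruct q.
now rewrite (proof_irrelevance _ p (mid_ml B n g)), <- ι_rew_cod, eps_ml.
Qed.

Lemma mu_M {b c d} (m : C c d) (g : C b c) (p : F (m ∘ g) = F g) :
  in_sub M m -> ι (μ (m ∘ g)) = m ∘ ι (μ g) ∘ eq_hom p.
Proof.
intros [n q]; destruct q.
rewrite (proof_irrelevance _ p (mid_ml B n g)).
now rewrite (ι_rew_dom (mid_ml B n g)), mu_ml, imap_comp.
Qed.

Lemma eps_E {a b c} (g : C b c) (e : C a b) (p : F (g ∘ e) = F g) :
  in_sub E e -> eq_hom p ∘ ι (ε (g ∘ e)) = ι (ε g) ∘ e.
Proof.
intros [n q]; destruct q.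
rewrite (proof_irrelevance _ p (mid_er B g n)).
now rewrite <- ι_rew_cod, eps_er, imap_comp.
Qed.

Lemma mu_E {a b c} (g : C b c) (e : C a b) (p : F (g ∘ e) = F g) :
  in_sub E e -> ι (μ (g ∘ e)) = ι (μ g) ∘ eq_hom p.
Proof.
intros [n q]; destruct q.
rewrite (proof_irrelevance _ p (mid_er B g n)).
now rewrite (ι_rew_dom (mid_er B g n)), mu_er.
Qed.

(* The first and last factors of [bfs_fmap s] only depend on [bot s] and
   [top s], not on their factorizations. *)
Lemma bfs_fmapE (f g : arrow C) (s : square f g)
    (p : F (bot s ∘ ι (μ (arr f))) = F (ι (ε (arr g)) ∘ top s)) :
  bfs_fmap s = ι (μ (ι (ε (arr g)) ∘ top s)) ∘ eq_hom p
               ∘ ι (ε (bot s ∘ ι (μ (arr f)))).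
Proof.
revert p; unfold bfs_fmap.
generalize (mid_square s); intros q.
set (e := ι (ε (arr g))) in *; set (m := ι (μ (arr f))) in *.
assert (Hu : e ∘ top s = (e ∘ ι (μ (top s))) ∘ ι (ε (top s))).
{ now rewrite <- comp_assoc, <- mu_eps. }
assert (Hv : bot s ∘ m = ι (μ (bot s)) ∘ (ι (ε (bot s)) ∘ m)).
{ now rewrite comp_assoc, <- mu_eps. }
rewrite Hu, Hv; intros p.
rewrite (mu_E (mid_er B _ _)) by apply in_sub_ι.
rewrite <- (@eps_M _ _ _ (ι (μ (bot s))) _ (mid_ml B _ _)) by apply in_sub_ι.
rewrite !comp_assoc; f_equal.
rewrite <- !comp_assoc; f_equal.
rewrite (eq_hom_trans _ _ (eq_trans (mid_ml B _ _) q)).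
symmetry; apply eq_hom_trans.
Qed.

Lemma bfs_fmap_id (f : arrow C) : bfs_fmap (square_id f) = idm (F (arr f)).
Proof.
assert (p : F (idm (tgt f) ∘ ι (μ (arr f))) = F (ι (ε (arr f)) ∘ idm (src f))).
{ rewrite comp_idl, comp_idr.
  rewrite <- (comp_idr (ι (μ (arr f)))), <- (comp_idl (ι (ε (arr f)))).
  now rewrite (mid_ml B), (mid_er B). }
rewrite (bfs_fmapE (s := square_id f) p); simpl; revert p.
rewrite comp_idl, comp_idr.
rewrite <- (comp_idr (ι (μ (arr f)))), <- (comp_idl (ι (ε (arr f)))).
intros p.
rewrite (mu_E (mid_er B _ _)) by apply in_sub_ι.
rewrite <- (comp_assoc _ (eq_hom _) (eq_hom _)).
rewrite (eq_hom_trans _ _ (mid_ml B _ _)).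
rewrite <- comp_assoc, eps_M by apply in_sub_ι.
symmetry; apply mu_eps.
Qed.

Lemma mid_fill (f g : arrow C) (s : square f g) :
  F (bot s ∘ ι (μ (arr f))) = F (ι (ε (arr g)) ∘ top s).
Proof.
rewrite <- (mid_er B _ (ε (arr f))), <- comp_assoc, <- mu_eps.
rewrite <- (mid_ml B (μ (arr g))), comp_assoc, <- mu_eps.
now rewrite square_comm.
Qed.

(* The square (u, v) : f -> g acts as a filler: F(u, v) ε(f) = ε(g) u. *)
Lemma bfs_fmap_eps (f g : arrow C) (s : square f g) :
  bfs_fmap s ∘ ι (ε (arr f)) = ι (ε (arr g)) ∘ top s.
Proof.
pose proof (mid_fill s) as p.
rewrite (bfs_fmapE p), <- comp_assoc.
pose proof (eps_E (mid_er B (bot s ∘ ι (μ (arr f))) (ε (arr f)))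
              (in_sub_ι (ε (arr f)))) as HE.
pose proof (@eps_M _ _ _ (ι (μ (arr g))) (ι (ε (arr g)) ∘ top s)
              (mid_ml B _ _) (in_sub_ι (μ (arr g)))) as HM.
rewrite <- HE; clear HE.
assert (q : (bot s ∘ ι (μ (arr f))) ∘ ι (ε (arr f))
            = ι (μ (arr g)) ∘ (ι (ε (arr g)) ∘ top s)).
{ rewrite <- comp_assoc, <- mu_eps, comp_assoc, <- mu_eps.
  symmetry; apply square_comm. }
rewrite (eps_cong (f_equal F q) q), comp_assoc in HM.
etransitivity; [|symmetry; apply (mu_eps B)].
rewrite <- comp_assoc; f_equal.
etransitivity; [|exact HM]; rewrite !comp_assoc; f_equal.
rewrite (eq_hom_trans _ _ (eq_trans (mid_er B _ _) p)).
symmetry; apply eq_hom_trans.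
Qed.

Lemma bfs_fmap_mu (f g : arrow C) (s : square f g) :
  ι (μ (arr g)) ∘ bfs_fmap s = bot s ∘ ι (μ (arr f)).
Proof.
rewrite (bfs_fmapE (mid_fill s)).
pose proof (mu_E (mid_er B (bot s ∘ ι (μ (arr f))) (ε (arr f)))
              (in_sub_ι (ε (arr f)))) as HE.
pose proof (@mu_M _ _ _ (ι (μ (arr g))) (ι (ε (arr g)) ∘ top s)
              (mid_ml B _ _) (in_sub_ι (μ (arr g)))) as HM.
assert (q : (bot s ∘ ι (μ (arr f))) ∘ ι (ε (arr f))
            = ι (μ (arr g)) ∘ (ι (ε (arr g)) ∘ top s)).
{ rewrite <- comp_assoc, <- mu_eps, comp_assoc, <- mu_eps.
  symmetry; apply square_comm. }
rewrite (mu_cong (f_equal F q) q), HM in HE.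
etransitivity; [|symmetry; apply (mu_eps B)].
rewrite !comp_assoc; f_equal.
apply (eq_hom_cancel (p := mid_er B (bot s ∘ ι (μ (arr f))) (ε (arr f)))).
refine (eq_trans _ HE); apply eq_hom_swap.
Qed.

Lemma bfs_fmap_comp (f g h : arrow C) (t : square g h) (s : square f g) :
  bfs_fmap (square_comp t s) = bfs_fmap t ∘ bfs_fmap s.
Proof.
set (L := ι (μ (ι (ε (arr g)) ∘ top s)) ∘ eq_hom (mid_fill s)).
set (R := ι (ε (bot s ∘ ι (μ (arr f))))).
set (L' := ι (μ (ι (ε (arr h)) ∘ top t)) ∘ eq_hom (mid_fill t)).
set (R' := ι (ε (bot t ∘ ι (μ (arr g))))).
assert (Fs : bfs_fmap s = L ∘ R) by apply bfs_fmapE.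
assert (Ft : bfs_fmap t = L' ∘ R') by apply bfs_fmapE.
assert (ML' : in_sub M L')
  by (apply in_sub_comp; [apply in_sub_ι | apply in_sub_eq_hom]).
assert (ER : in_sub E R) by apply in_sub_ι.
set (w := eq_hom (eq_sym (mid_fill s)) ∘ ι (ε (ι (ε (arr g)) ∘ top s))).
assert (Ew : in_sub E w)
  by (apply in_sub_comp; [apply in_sub_eq_hom | apply in_sub_ι]).
assert (Lw : L ∘ w = ι (ε (arr g)) ∘ top s).
{ unfold L, w.
  rewrite comp_assoc, <- (comp_assoc _ (eq_hom _) (eq_hom _)).
  rewrite (eq_hom_trans _ _ eq_refl), eq_hom_refl, comp_idr.
  symmetry; apply mu_eps. }
set (k := R' ∘ L).
assert (Hm : (L' ∘ k) ∘ w = ι (ε (arr h)) ∘ (top t ∘ top s)).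
{ unfold k.
  rewrite (comp_assoc L'), <- Ft, <- comp_assoc, Lw, comp_assoc.
  rewrite bfs_fmap_eps; symmetry; apply comp_assoc. }
assert (He : ι (μ (bot t ∘ ι (μ (arr g)))) ∘ (k ∘ R)
             = (bot t ∘ bot s) ∘ ι (μ (arr f))).
{ unfold k; rewrite <- (comp_assoc R'), <- Fs, comp_assoc.
  unfold R'; rewrite <- mu_eps, <- comp_assoc, bfs_fmap_mu.
  apply comp_assoc. }
pose proof (mu_M (mid_M k ML') ML') as H1.
pose proof (mu_E (mid_E (L' ∘ k) Ew) Ew) as H2.
rewrite (mu_cong (f_equal F Hm) Hm), H1 in H2.
pose proof (eps_E (mid_E k ER) ER) as H3.
pose proof (eps_M (mid_M (k ∘ R) (in_sub_ι (μ (bot t ∘ ι (μ (arr g))))))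
             (in_sub_ι (μ (bot t ∘ ι (μ (arr g)))))) as H4.
rewrite <- H4 in H3.
rewrite (bfs_fmapE (mid_fill (square_comp t s))); simpl.
rewrite (eps_cong (f_equal F He) He).
transitivity ((L' ∘ ι (μ k)) ∘ (ι (ε k) ∘ R)).
{ exact (eq_hom_glue _ _ H2 H3). }
rewrite Ft, Fs, <- (comp_assoc L'), (comp_assoc _ _ R), <- mu_eps.
unfold k; rewrite !comp_assoc; reflexivity.
Qed.

Definition bfs_functor : functor (arrow_cat C) C :=
  @Functor _ _ (arrow_cat C) C
    (fun f => F (arr f)) bfs_fmap bfs_fmap_id bfs_fmap_comp.

End BilinearFunctor.

(* Main.v *)
From Stdlib Require Import ProofIrrelevance.
Require Import Defs.

Set Implicit Arguments.
Unset Strict Implicit.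

(** Every object is isomorphic to the middle object of its identity: [ε(1_x)]
    and [μ(1_x)] are mutually inverse ([mu_eps_id], [eps_mu_id]).  One composite
    is the factorization of [1_x]; the other one is [F(1,1)], read off the
    definition of [F] on morphisms, and functoriality makes it an identity.

    Since [F(u,v)] is compatible with [ε] and [μ], this turns the two classes
    into simpler ones ([left_classE], [right_classE]): [f] is in the left class
    iff [μ(f)] is invertible, and in the right class iff [ε(f)] is invertible.
    For [f] in the image of E, [μ(f)] is a transport of [μ(1)], hence invertible;
    dually for M.  So the factorization [f = μ(f) ε(f)] decomposes every
    morphism along the two classes.

    If [f] is in the left class and [m] in the right class, a square [(u,v)]
    from [f] to [m] has the filler [ε(m)⁻¹ F(u,v) μ(f)⁻¹].  It is unique because
    a filler [t] splits the square as [(1,m) (t,t) (f,1)], so that functoriality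
    recovers [t] from [F(u,v)] ([classes_orthogonal]).

    Conversely, a morphism orthogonal to the whole right class is in the left
    class, by filling the square with top [ε(f)], bottom an identity and right
    side [μ(f)] ([orthogonal_right_factor_iso]), and dually.  Orthogonality is
    stable under composition and holds for isomorphisms, so both classes are
    subcategories containing all isomorphisms. *)

(** * Isomorphisms and orthogonality in a category *)

Section Orthogonality.
Context {O : Type} {C : category O}.

Lemma idm_iso (a : O) : is_iso (C := C) (idm a).
Proof. exists (idm a); split; apply comp_idl. Qed.

Lemma eq_hom_iso {x y : O} (p : x = y) : is_iso (C := C) (eq_hom p).
Proof. destruct p; apply idm_iso. Qed.

Lemma iso_comp {a b c : O} (g : C b c) (f : C a b) :
  is_iso g -> is_iso f -> is_iso (g ∘ f).
Proof.
intros [g' [g'g gg']] [f' [f'f ff']]; exists (f' ∘ g'); split.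
- now rewrite <- comp_assoc, (comp_assoc g'), g'g, comp_idl.
- now rewrite <- comp_assoc, (comp_assoc f), ff', comp_idl.
Qed.

Lemma iso_inv {a b : O} (f : C a b) (g : C b a) :
  g ∘ f = idm a -> f ∘ g = idm b -> is_iso g.
Proof. intros gf fg; now exists f. Qed.

Lemma iso_cancel_l {a b c : O} (g : C b c) (f : C a b) :
  is_iso g -> is_iso (g ∘ f) <-> is_iso f.
Proof.
intros Hg; split; [intros Hgf | now apply iso_comp].
destruct Hg as [g' [g'g gg']].
rewrite <- (comp_idl f), <- g'g, <- comp_assoc.
apply iso_comp; [exact (iso_inv g'g gg') | exact Hgf].
Qed.

Lemma iso_cancel_r {a b c : O} (g : C b c) (f : C a b) :
  is_iso f -> is_iso (g ∘ f) <-> is_iso g.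
Proof.
intros Hf; split; [intros Hgf | now intros Hg; apply iso_comp].
destruct Hf as [f' [f'f ff']].
rewrite <- (comp_idr g), <- ff', comp_assoc.
apply iso_comp; [exact Hgf | exact (iso_inv f'f ff')].
Qed.

Lemma iso_monic {a b c : O} (g : C b c) (s t : C a b) :
  is_iso g -> g ∘ s = g ∘ t -> s = t.
Proof.
intros [g' [g'g _]] H.
now rewrite <- (comp_idl s), <- g'g, <- comp_assoc, H, comp_assoc, g'g, comp_idl.
Qed.

Lemma iso_epic {a b c : O} (f : C a b) (s t : C b c) :
  is_iso f -> s ∘ f = t ∘ f -> s = t.
Proof.
intros [f' [_ ff']] H.
now rewrite <- (comp_idr s), <- ff', comp_assoc, H, <- comp_assoc, ff', comp_idr.
Qed.

Definition orthogonal {x a y b : O} (e : C x a) (m : C y b) : Prop :=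
  forall (u : C x y) (v : C a b), m ∘ u = v ∘ e ->
  exists! t : C a y, t ∘ e = u /\ m ∘ t = v.

Lemma orthogonal_iso_l {x a y b : O} (e : C x a) (m : C y b) :
  is_iso e -> orthogonal e m.
Proof.
intros He u v H; destruct (He) as [e' [e'e ee']]; exists (u ∘ e').
assert (Hu : (u ∘ e') ∘ e = u) by now rewrite <- comp_assoc, e'e, comp_idr.
split; [split; [exact Hu|]|].
- now rewrite comp_assoc, H, <- comp_assoc, ee', comp_idr.
- intros t [Ht _]; apply (iso_epic He); congruence.
Qed.

Lemma orthogonal_iso_r {x a y b : O} (e : C x a) (m : C y b) :
  is_iso m -> orthogonal e m.
Proof.
intros Hm u v H; destruct (Hm) as [m' [m'm mm']]; exists (m' ∘ v).
assert (Hv : m ∘ (m' ∘ v) = v) by now rewrite comp_assoc, mm', comp_idl.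
split; [split; [|exact Hv]|].
- now rewrite <- comp_assoc, <- H, comp_assoc, m'm, comp_idl.
- intros t [_ Ht]; apply (iso_monic Hm); congruence.
Qed.

Lemma orthogonal_comp_l {x a c y b : O} (e' : C a c) (e : C x a) (m : C y b) :
  orthogonal e' m -> orthogonal e m -> orthogonal (e' ∘ e) m.
Proof.
intros He' He u v H; rewrite comp_assoc in H.
destruct (He u (v ∘ e') H) as [t [[te mt] t_uniq]].
destruct (He' t v mt) as [s [[se' ms] s_uniq]].
exists s; split; [split; [now rewrite comp_assoc, se' | exact ms]|].
intros r [re mr]; rewrite comp_assoc in re.
apply s_uniq; split; [|exact mr].
symmetry; apply t_uniq; split; [exact re|].
now rewrite comp_assoc, mr.
Qed.

Lemma orthogonal_comp_r {x a y b c : O} (e : C x a) (m' : C b c) (m : C y b) :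
  orthogonal e m' -> orthogonal e m -> orthogonal e (m' ∘ m).
Proof.
intros Hm' Hm u v H; rewrite <- comp_assoc in H.
destruct (Hm' (m ∘ u) v H) as [t [[te mt] t_uniq]].
destruct (Hm u t (eq_sym te)) as [s [[se ms] s_uniq]].
exists s; split; [split; [exact se | now rewrite <- comp_assoc, ms]|].
intros r [re mr]; rewrite <- comp_assoc in mr.
apply s_uniq; split; [exact re|].
symmetry; apply t_uniq; split; [|exact mr].
now rewrite <- comp_assoc, re.
Qed.

(** The filler of the square [m e = 1 (m e)] is a section [t] of [m]; both
    [t m] and the identity fill the square [m e = m e], so [t] is also a
    retraction. *)
Lemma orthogonal_right_factor_iso {a y b : O} (e : C a y) (m : C y b) :
  orthogonal e m -> orthogonal (m ∘ e) m -> is_iso m.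
Proof.
intros He Hf.
destruct (Hf e (idm b) (eq_sym (comp_idl _))) as [t [[tf mt] _]].
destruct (He e m eq_refl) as [r [_ r_uniq]].
exists t; split; [|exact mt].
rewrite <- (r_uniq (t ∘ m)).
- apply r_uniq; split; [apply comp_idl | apply comp_idr].
- split; [now rewrite <- comp_assoc|].
  now rewrite comp_assoc, mt, comp_idl.
Qed.

Lemma orthogonal_left_factor_iso {a y b : O} (e : C a y) (m : C y b) :
  orthogonal e m -> orthogonal e (m ∘ e) -> is_iso e.
Proof.
intros Hm Hf.
destruct (Hf (idm a) m (comp_idr _)) as [t [[te ft] _]].
destruct (Hm e m eq_refl) as [r [_ r_uniq]].
exists t; split; [exact te|].
rewrite <- (r_uniq (e ∘ t)).
- apply r_uniq; split; [apply comp_idl | apply comp_idr].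
- split; [now rewrite <- comp_assoc, te, comp_idr|].
  now rewrite comp_assoc.
Qed.

End Orthogonality.

(** * The subcategory on a class of morphisms *)

Section WideSubcategory.
Context {O : Type} {C : category O}.
Variable P : forall a b : O, C a b -> Prop.
Hypothesis P_id : forall a, P (idm a).
Hypothesis P_comp :
  forall a b c (g : C b c) (f : C a b), P g -> P f -> P (g ∘ f).

Lemma wide_hom_eq {a b : O} (f g : {f : C a b | P f}) :
  proj1_sig f = proj1_sig g -> f = g.
Proof.
destruct f as [f Hf], g as [g Hg]; simpl; intros ->.
now rewrite (proof_irrelevance _ Hf Hg).
Qed.

Definition wide_category : category O.
Proof.
refine (@Category O (fun a b => {f : C a b | P f})
  (fun a => exist _ (idm a) (P_id a))
  (fun a b c g f =>
     exist _ (proj1_sig g ∘ proj1_sig f) (P_comp (proj2_sig g) (proj2_sig f)))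
  _ _ _); intros; apply wide_hom_eq; simpl.
- apply comp_assoc.
- apply comp_idl.
- apply comp_idr.
Defined.

Definition wide_subcategory : subcategory C :=
  @Subcategory O C wide_category
    (@IooFunctor O wide_category C (fun a b f => proj1_sig f)
       (fun a => eq_refl) (fun a b c g f => eq_refl))
    (fun a b f g => @wide_hom_eq a b f g).

Lemma in_wide_subcategory {a b : O} (f : C a b) :
  in_sub wide_subcategory f <-> P f.
Proof.
split; [now intros [[g Hg] <-] | intros Hf].
now exists (exist _ f Hf : wide_subcategory a b).
Qed.

Lemma factors_through_wide (D : subcategory C) :
  (forall a b (f : D a b), P (ι f)) -> factors_through D wide_subcategory.
Proof.
intros H.
unshelve eexists (@IooFunctor O D wide_subcategory
  (fun a b f => exist _ (ι f) (H a b f)) _ _).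
- intros a; apply wide_hom_eq, imap_id.
- intros a b c g f; apply wide_hom_eq, imap_comp.
- reflexivity.
Qed.

End WideSubcategory.

(** * The classes associated with a bilinear factorization system *)

Section AssociatedFactorization.
Context {O : Type} {C : category O} {E M : subcategory C}.
Variable B : bilinear_fs E M.

Local Notation ε f := (ι (eps B f)).
Local Notation μ f := (ι (mu B f)).
Local Notation F := (fmap (bfs_functor B)).

Lemma mu_eps_id (x : O) : μ (idm x) ∘ ε (idm x) = idm x.
Proof. symmetry; apply mu_eps. Qed.

(** Both outer factors of [F(1,1)] come from factorizing [ε(1) μ(1)], so [F(1,1)]
    is that composite; functoriality makes it an identity. *)
Lemma eps_mu_id (x : O) : ε (idm x) ∘ μ (idm x) = idm (mid B (idm x)).
Proof.
refine (eq_trans _ (bfs_fmap_id B (Arrow (idm x)))); unfold bfs_fmap; simpl.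
rewrite eq_hom_refl, comp_idr; apply mu_eps.
Qed.

Lemma eps_id_iso (x : O) : is_iso (ε (idm x)).
Proof. exact (iso_inv (eps_mu_id x) (mu_eps_id x)). Qed.

Lemma mu_id_iso (x : O) : is_iso (μ (idm x)).
Proof. exact (iso_inv (mu_eps_id x) (eps_mu_id x)). Qed.

Lemma left_classE {a x : O} (f : C a x) :
  left_class (bfs_functor B) f <-> is_iso (μ f).
Proof.
assert (H : μ (idm x) ∘ F (to_id f) = μ f)
  by exact (eq_trans (bfs_fmap_mu B (to_id f)) (comp_idl _)).
rewrite <- H; symmetry; apply iso_cancel_l, mu_id_iso.
Qed.

Lemma right_classE {a x : O} (f : C a x) :
  right_class (bfs_functor B) f <-> is_iso (ε f).
Proof.
assert (H : F (from_id f) ∘ ε (idm a) = ε f)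
  by exact (eq_trans (bfs_fmap_eps B (from_id f)) (comp_idr _)).
rewrite <- H; symmetry; apply iso_cancel_r, eps_id_iso.
Qed.

(** [μ(e)] is a transport of [μ(1)], because [e = 1 e]. *)
Lemma left_class_E {a b : O} (e : E a b) : left_class (bfs_functor B) (ι e).
Proof.
apply left_classE; rewrite <- (comp_idl (ι e)).
rewrite (mu_E (mid_er B _ e)) by apply in_sub_ι.
apply iso_comp; [apply mu_id_iso | apply eq_hom_iso].
Qed.

Lemma right_class_M {a b : O} (m : M a b) : right_class (bfs_functor B) (ι m).
Proof.
apply right_classE; rewrite <- (comp_idr (ι m)).
apply (iso_cancel_l _ (eq_hom_iso (mid_ml B m (idm a)))).
rewrite eps_M by apply in_sub_ι; apply eps_id_iso.
Qed.

Definition id_square {a y : O} (t : C a y) :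
    arrow_cat C (Arrow (idm a)) (Arrow (idm y)) :=
  @Square O C (Arrow (idm a)) (Arrow (idm y)) t t
    (eq_trans (comp_idl t) (eq_sym (comp_idr t))).

Lemma fmap_id_square {a y : O} (t : C a y) :
  F (id_square t) ∘ ε (idm a) = ε (idm y) ∘ t.
Proof. exact (bfs_fmap_eps B (id_square t)). Qed.

(** [F(t,t)] is the conjugate of [t] by the isomorphisms [ε(1)]. *)
Lemma fmap_id_square_inj {a y : O} (s t : C a y) :
  F (id_square s) = F (id_square t) -> s = t.
Proof.
intros H; apply (iso_monic (eps_id_iso y)).
now rewrite <- !fmap_id_square, H.
Qed.

(** A filler [t] lets the square pass through [1_a] and [1_y]:
    [e -> 1_a -> 1_y -> m]. *)
Lemma square_filler_factor {x a y b : O} (e : C x a) (m : C y b) (t : C a y)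
    (s : arrow_cat C (Arrow e) (Arrow m)) :
  t ∘ e = top s -> m ∘ t = bot s ->
  F s = F (from_id m) ∘ (F (id_square t) ∘ F (to_id e)).
Proof.
intros te mt; rewrite <- !fmap_comp; f_equal.
apply square_eq; simpl.
- now rewrite comp_idl.
- now rewrite comp_idr.
Qed.

(** The classes say exactly that the outer factors in [square_filler_factor]
    are invertible, which gives uniqueness; existence needs the invertibility of
    [μ(e)] and [ε(m)] instead. *)
Lemma classes_orthogonal {x a y b : O} (e : C x a) (m : C y b) :
  left_class (bfs_functor B) e -> right_class (bfs_functor B) m ->
  orthogonal e m.
Proof.
intros He Hm u v H.
pose (s := @Square O C (Arrow e) (Arrow m) u v H
           : arrow_cat C (Arrow e) (Arrow m)).
assert (Hw : exists w : C (mid B e) (mid B m),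
  w ∘ ε e = ε m ∘ u /\ μ m ∘ w = v ∘ μ e)
  by exact (ex_intro _ (bfs_fmap B s)
              (conj (bfs_fmap_eps B s) (bfs_fmap_mu B s))).
destruct Hw as [w [Heps Hmu]].
destruct (proj1 (left_classE e) He) as [n [n_mu mu_n]].
destruct (proj1 (right_classE m) Hm) as [r [r_eps eps_r]].
set (t := r ∘ w ∘ n).
assert (te : t ∘ e = u).
{ refine (eq_trans (f_equal (comp t) (mu_eps B e)) _); unfold t.
  rewrite <- comp_assoc, (comp_assoc n), n_mu, comp_idl.
  now rewrite <- comp_assoc, Heps, comp_assoc, r_eps, comp_idl. }
assert (mt : m ∘ t = v).
{ refine (eq_trans (f_equal (fun k => k ∘ t) (mu_eps B m)) _); unfold t.
  rewrite <- comp_assoc, !(comp_assoc (ε m)), eps_r, comp_idl.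
  now rewrite comp_assoc, Hmu, <- comp_assoc, mu_n, comp_idr. }
exists t; split; [now split|].
intros t' [te' mt']; apply fmap_id_square_inj.
apply (iso_epic He), (iso_monic Hm).
now rewrite <- (square_filler_factor (s := s) te mt),
            <- (square_filler_factor (s := s) te' mt').
Qed.

Lemma left_class_of_orthogonal {a b : O} (f : C a b) :
  (forall c d (m : C c d), right_class (bfs_functor B) m -> orthogonal f m) ->
  left_class (bfs_functor B) f.
Proof.
intros H; apply left_classE, (orthogonal_right_factor_iso (e := ε f)).
- apply classes_orthogonal; [apply left_class_E | apply right_class_M].
- rewrite <- mu_eps; apply H, right_class_M.
Qed.

Lemma right_class_of_orthogonal {a b : O} (f : C a b) :
  (forall c d (e : C c d), left_class (bfs_functor B) e -> orthogonal e f) ->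
  right_class (bfs_functor B) f.
Proof.
intros H; apply right_classE, (orthogonal_left_factor_iso (m := μ f)).
- apply classes_orthogonal; [apply left_class_E | apply right_class_M].
- rewrite <- mu_eps; apply H, left_class_E.
Qed.

Lemma left_class_iso {a b : O} (f : C a b) :
  is_iso f -> left_class (bfs_functor B) f.
Proof.
intros Hf; apply left_class_of_orthogonal; intros.
now apply orthogonal_iso_l.
Qed.

Lemma right_class_iso {a b : O} (f : C a b) :
  is_iso f -> right_class (bfs_functor B) f.
Proof.
intros Hf; apply right_class_of_orthogonal; intros.
now apply orthogonal_iso_r.
Qed.

Lemma left_class_comp {a b c : O} (g : C b c) (f : C a b) :
  left_class (bfs_functor B) g -> left_class (bfs_functor B) f ->
  left_class (bfs_functor B) (g ∘ f).
Proof.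
intros Hg Hf; apply left_class_of_orthogonal; intros x y m Hm.
apply orthogonal_comp_l; now apply classes_orthogonal.
Qed.

Lemma right_class_comp {a b c : O} (g : C b c) (f : C a b) :
  right_class (bfs_functor B) g -> right_class (bfs_functor B) f ->
  right_class (bfs_functor B) (g ∘ f).
Proof.
intros Hg Hf; apply right_class_of_orthogonal; intros x y e He.
apply orthogonal_comp_r; now apply classes_orthogonal.
Qed.

Definition left_subcategory : subcategory C :=
  wide_subcategory (fun a => left_class_iso (idm_iso a)) (@left_class_comp).

Definition right_subcategory : subcategory C :=
  wide_subcategory (fun a => right_class_iso (idm_iso a)) (@right_class_comp).

Lemma associated_orthogonal_fs :
  orthogonal_fs left_subcategory right_subcategory.
Proof.
split.
- now intros a b f Hf; apply in_wide_subcategory, left_class_iso.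
- now intros a b f Hf; apply in_wide_subcategory, right_class_iso.
- intros a b f; exists (mid B f).
  exists (exist _ (ε f) (left_class_E (eps B f))).
  exists (exist _ (μ f) (right_class_M (mu B f))).
  apply mu_eps.
- intros x a y b [e He] [m Hm]; exact (classes_orthogonal He Hm).
Qed.

End AssociatedFactorization.

Theorem corollary3p8 (O : Type) (C : category O) (E M : subcategory C)
    (B : bilinear_fs E M) :
  exists Ebar Mbar : subcategory C,
    (forall (a x : O) (f : C a x),
        in_sub Ebar f <-> left_class (bfs_functor B) f) /\
    (forall (a x : O) (f : C a x),
        in_sub Mbar f <-> right_class (bfs_functor B) f) /\
    orthogonal_fs Ebar Mbar /\
    factors_through E Ebar /\
    factors_through M Mbar.
Proof.
exists (left_subcategory B), (right_subcategory B).
split; [intros; apply in_wide_subcategory|].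
split; [intros; apply in_wide_subcategory|].
split; [apply associated_orthogonal_fs|].
split; apply factors_through_wide; intros.
- apply left_class_E.
- apply right_class_M.
Qed.
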